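(* For every integer $n\ge 1$, \[ d_n > c\,\frac{2^n}{n}\qquad\text{with } c=\frac{1}{201}. \]
   Context: For a positive integer $n$, let $\mathcal{D}_n=\{\det(M) : M\in\{0,1\}^{n\times n}\}\subset\mathbb{Z}$ be the set of determinants of $n\times n$ matrices with all entries in $\{0,1\}$. Let $d_n$ denote the smallest natural number that is not in $\mathcal{D}_n$. *)

(* Defs.v *)
From HB Require Import structures.
From mathcomp Require Import all_boot all_order all_algebra.

Set Implicit Arguments.
Unset Strict Implicit.
Unset Printing Implicit Defensive.

Import Order.TTheory GRing.Theory Num.Theory.

Local Open Scope ring_scope.

(* A {0,1}-matrix is encoded as a boolean matrix, so that there are finitely
   many of them; [intmx] reads false as 0 and true as 1. *)
Definition intmx (n : nat) (B : 'M[bool]_n) : 'M[int]_n :=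
  map_mx (fun b : bool => b%:R) B.

Definition detset (n : nat) : {pred int} :=
  [pred z | [exists B : 'M[bool]_n, \det (intmx B) == z]].

Lemma detsetP (n : nat) (z : int) :
  reflect (exists2 M : 'M[int]_n,
             (forall i j, M i j = 0 \/ M i j = 1) & \det M = z)
          (z \in detset n).
Proof.
apply: (iffP existsP) => [[B /eqP detB] | [M M01 detM]].
  exists (intmx B) => // i j; rewrite mxE.
  by case: (B i j); [right | left].
exists (map_mx (fun x => x == 1) M); apply/eqP; rewrite -detM.
congr (\det _); apply/matrixP => i j; rewrite !mxE.
by case: (M01 i j) => ->.
Qed.

Lemma ex_notin_detset (n : nat) : exists m : nat, m%:Z \notin detset n.
Proof.
exists (\max_(B : 'M[bool]_n) absz (\det (intmx B))).+1.
apply/existsP => -[B /eqP detB].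
have := leq_bigmax (F := fun B : 'M[bool]_n => absz (\det (intmx B))) B.
by rewrite detB /= ltnn.
Qed.

(* Natural numbers include 0; since 0 is the determinant of the zero matrix,
   starting from 1 would give the same number for n >= 1. *)
Definition min_nondet (n : nat) : nat := ex_minn (ex_notin_detset n).

(* Main.v *)
Require Import Defs.
From mathcomp Require Import all_boot all_order all_algebra.
From mathcomp Require Import perm zify.

Import Order.TTheory GRing.Theory Num.Theory.

Local Open Scope ring_scope.

(** The construction rests on numbers [v_0, v_1, ...] that nearly double and
    yet are linked by linear relations with coefficients in {-1, 0, 1}: the
    multinacci numbers of order [q], with [v_0 = 1] and
    [v_i = v_(i-1) + ... + v_(i-q)] (terms of negative index dropped).

    Let [G] be the square matrix whose rows [i > 0] are the relations
    [g_i = e_(i-q) + ... + e_(i-1) - e_i], all orthogonal to [v], and whose row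
    [0] is a 0/1 vector [x]. Away from row and column [0] it is triangular with
    diagonal [-1], so that [\det G = +/- \sum_j x_j v_j]
    ([det_relation_mx]). Since [v_i <= 1 + \sum_(j < i) v_j], such sums run
    through all integers from 0 to [S = \sum_j v_j] ([subset_sum_interval]).

    The entries [-1] of [G] are removed at the price of [q + 1] further rows and
    columns. For each residue [r] modulo [q + 1] let [h_r] be the indicator of
    the indices congruent to [r]. If [i] is congruent to [r], then [h_r] has a
    1 at [i] and zeros at the [q] positions before it, exactly the pattern that
    adding [g_i] replaces by its complement; hence [h_r + g_i] is again a 0/1
    vector. Appending the rows [h_r], and new columns that label each row by
    its residue, gives a 0/1 matrix in which subtracting the rows [h_r] brings
    back [G] without changing the determinant ([lifted_mxE],
    [det_block_dr1]).

    A matrix of size [n] thus leaves [N = n - q - 1] numbers [v_i]. Their sum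
    is at least [2 ^ N / 2 - N * 2 ^ N / 2 ^ (q + 1)]
    ([multinacci_sum_lb]), so [2 ^ q] should be of the order of [n]: then only
    a constant factor is lost in the sum, while the [q + 1] extra columns cost
    a factor of order [n]. This yields every integer up to
    [2 ^ n / (32 * n)]. *)

(** * Multinacci numbers *)

(** The recurrence reaches back [q] steps, so the recursion carries the list of
    all earlier values, the most recent one first. *)
Fixpoint multinacci_rev (q n : nat) : seq nat :=
  if n is n'.+1 then
    let s := multinacci_rev q n' in sumn (take q s) :: s
  else [:: 1%N].

Definition multinacci (q n : nat) : nat := head 0%N (multinacci_rev q n).

Lemma multinacci_revE (q n : nat) :
  multinacci_rev q n = [seq multinacci q (n - i) | i <- iota 0 n.+1].
Proof.
elim: n => [//|n IHn].
rewrite -[RHS]/(multinacci q n.+1 ::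
  [seq multinacci q (n.+1 - i) | i <- iota (1 + 0) n.+1]).
by rewrite iotaDl -map_comp; congr cons; exact: IHn.
Qed.

Lemma multinacciS (q n : nat) :
  multinacci q n.+1 =
  (\sum_(j < n.+1 | (n < j + q)%N) multinacci q j)%N.
Proof.
rewrite {1}/multinacci /= multinacci_revE -map_take take_iota sumnE big_map.
rewrite -{1}[minn _ _]subn0 -/(index_iota 0 _).
rewrite (big_nat_widen _ _ n.+1) ?geq_minr //=.
rewrite -(big_mkord (fun j => (n < j + q)%N) (multinacci q)) [RHS]big_nat_rev.
rewrite add0n big_nat_cond [RHS]big_nat_cond.
by apply: eq_big => [i|i _]; [lia | rewrite subSS].
Qed.

Definition multinacci_sum (q N : nat) : nat := (\sum_(j < N) multinacci q j)%N.

(** By the recurrence, [v_(N+1)] is a sum of consecutive terms and so a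
    difference of two partial sums: the sums double, up to a partial sum over
    [q] terms fewer. The truncated subtraction takes care of the short
    initial windows. *)
Lemma multinacci_sumS (q N : nat) :
  (multinacci_sum q N.+2 + multinacci_sum q (N.+1 - q) =
   2 * multinacci_sum q N.+1)%N.
Proof.
rewrite {1}/multinacci_sum big_ord_recr /= -/(multinacci_sum q N.+1).
rewrite mul2n -addnn -addnA; congr (_ + _)%N.
rewrite multinacciS -(big_mkord (fun j => (N < j + q)%N) (multinacci q)).
rewrite /multinacci_sum -!(big_mkord xpredT (multinacci q)).
rewrite [RHS](bigID (fun j => (N < j + q)%N)) /=; congr (_ + _)%N.
rewrite (big_nat_widen _ _ N.+1) ?leq_subr //.
by apply: eq_bigl => j /=; lia.
Qed.

Lemma multinacci_sum_ub (q N : nat) : (multinacci_sum q N <= 2 ^ N)%N.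
Proof.
elim: N => [|[|N] IHN]; first by rewrite /multinacci_sum big_ord0.
  by rewrite /multinacci_sum big_ord1.
rewrite expnS; apply: leq_trans (leq_mul (leqnn 2) IHN).
by rewrite -multinacci_sumS leq_addr.
Qed.

(** Each doubling step loses a sum of index smaller by [q], hence at most
    [2 ^ (N + 1 - q)]; relative to [2 ^ N] every step loses the same proportion,
    and the losses add up to the second summand. *)
Lemma multinacci_sum_lb (q N : nat) :
  (2 ^ q * 2 ^ N.+1 <= 2 ^ q.+1 * multinacci_sum q N.+1 + N.+1 * 2 ^ N.+1)%N.
Proof.
elim: N => [|N IHN].
  rewrite /multinacci_sum big_ord1 -[multinacci _ _]/1%N.
  by rewrite muln1 expn1 expnSr leq_addr.
have loss : (2 ^ q * multinacci_sum q (N.+1 - q) <= 2 ^ N.+1)%N.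
  case: (leqP q N.+1) => [leqN | ltNq].
    by rewrite -{2}(subnKC leqN) expnD leq_mul2l multinacci_sum_ub orbT.
  have -> : (N.+1 - q = 0)%N by lia.
  by rewrite /multinacci_sum big_ord0 muln0.
have := multinacci_sumS q N.
move: loss IHN; rewrite [(2 ^ N.+2)%N]expnS [(2 ^ q.+1)%N]expnS.
move: (2 ^ N.+1)%N (2 ^ q)%N (multinacci_sum q N.+1) => P Q S.
move: (multinacci_sum q N.+2) (multinacci_sum _ _) => S2 S0.
nia.
Qed.

(** * Subset sums *)

(** A target that exceeds the sum of the first [N] weights is at least the next
    weight, which can be subtracted, leaving a target within reach. *)
Lemma subset_sum_interval (v : nat -> nat) (N d : nat) :
    (forall i, v i <= (\sum_(j < i) v j).+1)%N ->
    (d <= \sum_(j < N) v j)%N ->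
  exists x : nat -> bool, d = (\sum_(j < N) x j * v j)%N.
Proof.
move=> v_le; elim: N d => [|N IHN] d.
  by rewrite !big_ord0 leqn0 => /eqP ->; exists xpredT; rewrite big_ord0.
rewrite big_ord_recr /= => led.
have [leS | ltS] := leqP d (\sum_(j < N) v j).
  have [x ->] := IHN _ leS.
  exists (fun j => (j != N) && x j); rewrite big_ord_recr /= eqxx addn0.
  by apply: eq_bigr => j _; rewrite ltn_eqF.
have [|x dE] := IHN (d - v N)%N; first by rewrite leq_subLR addnC.
exists (fun j => (j == N) || x j); rewrite big_ord_recr /= eqxx mul1n.
rewrite -[LHS](subnK (leq_trans (v_le N) ltS)) dE; congr (_ + _)%N.
by apply: eq_bigr => j _; rewrite ltn_eqF.
Qed.

(** * Determinant identities *)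

(** Subtracting [E] times the lower block row from the upper one clears the
    upper right corner. *)
Lemma det_block_dr1 (R : comPzRingType) (p q : nat) (X : 'M[R]_p)
    (E : 'M[R]_(p, q)) (H : 'M[R]_(q, p)) :
  \det (block_mx X E H 1%:M) = \det (X - E *m H).
Proof.
have -> : block_mx X E H 1%:M =
    block_mx 1%:M E 0 1%:M *m block_mx (X - E *m H) 0 H 1%:M.
  by rewrite mulmx_block !(mul1mx, mulmx1, mul0mx, mulmx0, add0r) subrK.
by rewrite det_mulmx det_ublock det_lblock !det1 !mulr1 mul1r.
Qed.

(** Multiplying [G *m w] by the adjugate of [G] gives [\det G *: w]; when
    only one entry of [G *m w] survives, a single cofactor enters the
    comparison of the first coordinates. *)
Lemma det_kernel_column (R : comPzRingType) (p : nat) (G : 'M[R]_p.+1)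
    (w : 'cV[R]_p.+1) :
    w ord0 ord0 = 1 -> (forall i, i != ord0 -> (G *m w) i ord0 = 0) ->
  \det G = (G *m w) ord0 ord0 * cofactor G ord0 ord0.
Proof.
move=> w0 Gw0; have := mul_adj_mx G => /(congr1 (fun B => (B *m w) ord0 ord0)).
rewrite -mulmxA mul_scalar_mx [RHS]mxE w0 mulr1 mxE => <-.
rewrite (bigD1 ord0) //= big1 ?addr0 => [|i /Gw0 ->]; last by rewrite mulr0.
by rewrite [\adj G _ _]mxE mulrC.
Qed.

Lemma detsetN (n : nat) (z : int) :
  (1 < n)%N -> z \in detset n -> - z \in detset n.
Proof.
case: n => [//|[//|n]] _ /detsetP[M M01 <-]; apply/detsetP.
exists (xrow ord0 ord_max M) => [i j|]; first by rewrite mxE.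
by rewrite /xrow row_permE det_mulmx det_perm odd_tperm mulN1r.
Qed.

(** * A 0/1 matrix whose determinant is a chosen subset sum *)

Section Relations.

Variables (p q : nat) (x : nat -> bool).

(** The matrix [G] of the introduction. *)
Definition relation_mx : 'M[int]_p.+1 :=
  \matrix_(i < p.+1, j < p.+1) if i == ord0 then (x j)%:R
                 else (j < i <= j + q)%N%:R - (i == j)%:R.

(** Row [i > 0] is [h_r + g_i], where [r] is the residue of [i] modulo
    [q + 1]. *)
Definition lifted_mx : 'M[int]_p.+1 :=
  \matrix_(i < p.+1, j < p.+1) if i == ord0 then (x j)%:R
    else ((j < i <= j + q) || (i != j) && (i == j %[mod q.+1]))%N%:R.

Definition row_label_mx : 'M[int]_(p.+1, q.+1) :=
  \matrix_(i < p.+1, r < q.+1) ((i != ord0) && (i %% q.+1 == r)%N)%:R.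

(** Row [r] is [h_r]. *)
Definition residue_mx : 'M[int]_(q.+1, p.+1) :=
  \matrix_(r < q.+1, j < p.+1) (j %% q.+1 == r)%N%:R.

(** The point is that an index [j] with [i - q <= j < i] is never congruent to
    [i] modulo [q + 1], so the two alternatives in [lifted_mx] are exclusive. *)
Lemma lifted_mxE : lifted_mx - row_label_mx *m residue_mx = relation_mx.
Proof.
apply/matrixP => i j; rewrite !mxE.
have -> : \sum_(r < q.+1) row_label_mx i r * residue_mx r j =
    ((i != ord0) && (i == j %[mod q.+1])%N)%:R.
  rewrite (bigD1 (inord (j %% q.+1))) //= big1 => [|r].
    by rewrite !mxE inordK ?ltn_pmod // eqxx mulr1 addr0.
  rewrite -val_eqE /= inordK ?ltn_pmod // !mxE => /negPf.
  by rewrite eq_sym => ->; rewrite mulr0.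
case: eqVneq => [_|_] /=; first by rewrite subr0.
have [-> | neq_ij] := eqVneq i j; first by rewrite eqxx ltnn.
have [/andP[ltji leij] | _] /= := boolP (j < i <= j + q)%N; last first.
  by rewrite subrr subr0.
suff -> : (i == j %[mod q.+1]) = false by [].
rewrite eqn_mod_dvd; last exact: ltnW.
by rewrite gtnNdvd //; lia.
Qed.

(** The column [v] is orthogonal to every row but the first, which makes
    [det_kernel_column] applicable; the remaining cofactor is triangular with
    diagonal [-1]. *)
Lemma det_relation_mx :
  \det relation_mx = (\sum_(j < p.+1) x j * multinacci q j)%:R * (-1) ^+ p.
Proof.
pose w : 'cV[int]_p.+1 := \col_j (multinacci q j)%:R.
rewrite (@det_kernel_column _ _ _ w) ?mxE //.
  congr (_ * _).
    by rewrite natr_sum; apply: eq_bigr => j _; rewrite !mxE natrM.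
  rewrite /cofactor expr0 mul1r det_trig.
    rewrite (eq_bigr (fun _ => -1)) ?prodr_const ?card_ord // => i _.
    by rewrite !mxE /= ltnn eqxx sub0r.
  apply/is_trig_mxP => i j ltij; rewrite !mxE /=.
  rewrite (inj_eq lift_inj) -val_eqE /= ltn_eqF //.
  by rewrite /bump /= !add1n ltnS ltnNge ltnW.
move=> i i_neq0; rewrite mxE.
under eq_bigr => j _ do rewrite !mxE (negPf i_neq0) mulrBl.
rewrite sumrB (bigD1 i) //= [X in _ - X](bigD1 i) //=.
rewrite eqxx ltnn mul0r mul1r add0r.
rewrite [X in _ - (_ + X)]big1 ?addr0 => [|j]; last first.
  by rewrite eq_sym => /negPf ->; rewrite mul0r.
apply/eqP; rewrite subr_eq0; apply/eqP.
case: i i_neq0 => [[//|i] lti] /= _.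
rewrite multinacciS natr_sum.
rewrite (big_ord_widen_cond p.+1 (fun j => (i < j + q)%N)
  (fun j => (multinacci q j)%:R)) 1?ltnW //.
rewrite big_mkcond [RHS]big_mkcond /=; apply: eq_bigr => j _.
rewrite -val_eqE /= ltnS andbC.
have [->|_] /= := eqVneq (j : nat) i.+1; first by rewrite ltnn andbF.
by case: (_ && _); rewrite ?mul1r ?mul0r.
Qed.
End Relations.

Lemma multinacci_sum_detset (p q d : nat) :
  (d <= multinacci_sum q p.+1)%N -> d%:Z \in detset (p.+1 + q.+1).
Proof.
move=> led.
have v_le i : (multinacci q i <= (\sum_(j < i) multinacci q j).+1)%N.
  case: i => [|i]; first by rewrite big_ord0.
  rewrite multinacciS leqW //.
  by rewrite [leqRHS](bigID (fun j : 'I_i.+1 => i < j + q)%N) leq_addr.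
have [x ->] := subset_sum_interval _ _ _ v_le led.
set D := (\sum_(j < p.+1) _)%N.
have : D%:Z * (-1) ^+ p \in detset (p.+1 + q.+1).
  apply/detsetP.
  exists (block_mx (lifted_mx p q x) (row_label_mx p q) (residue_mx p q) 1%:M).
    move=> i j; rewrite !mxE.
    case: (split i) => k; rewrite mxE; case: (split j) => l; rewrite !mxE.
    - by case: ifP => _; [case: (x _)|case: (_ || _)]; [right|left|right|left].
    - by case: (_ && _); [right|left].
    - by case: (_ == _); [right|left].
    - by case: (_ == _); [right|left].
  by rewrite det_block_dr1 lifted_mxE det_relation_mx natz.
(* A row exchange corrects the sign when [p] is odd. *)
rewrite -signr_odd; case: (odd p); rewrite ?mulr1 // mulrN1 => /detsetN.
by rewrite opprK addnS; apply.
Qed.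

(** * The lower bound *)

(** The choice [q = t + 2] with [2 ^ t <= n < 2 ^ (t + 1)] makes
    [2 * (p + 1) <= 2 ^ q], so that the loss in [multinacci_sum_lb] is at most
    half of the main term, while [2 ^ q <= 4 * n] bounds the cost of the [q + 1]
    extra columns. *)
Lemma multinacci_sum_large (n : nat) : (6 <= n)%N ->
  exists p q, n = (p.+1 + q.+1)%N /\
    (2 ^ n <= 32 * n * multinacci_sum q p.+1)%N.
Proof.
move=> le6n.
have lt8n : (8 * n < 2 ^ n)%N.
  elim: n le6n => [//|n IHn].
  rewrite leq_eqVlt => /predU1P[<- //|le6n].
  by have := IHn le6n; rewrite expnS; move: (2 ^ n)%N => P; lia.
pose t := trunc_log 2 n.
have le_t : (2 ^ t <= n)%N by apply: trunc_logP => //; lia.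
have lt_t : (n < 2 * 2 ^ t)%N by rewrite -expnS trunc_log_ltn.
have lt_tn : (t.+3 < n)%N.
  rewrite ltnNge; apply/negP => le_nt.
  have : (2 ^ n <= 2 ^ (t.+3))%N by rewrite leq_exp2l.
  by rewrite !expnS; move: (2 ^ t)%N (2 ^ n)%N le_t lt8n => T P; lia.
have [p nE] : exists p, n = (p.+1 + t.+3)%N by exists (n - t.+4)%N; lia.
exists p, t.+2; split=> //.
have lb := multinacci_sum_lb t.+2 p.
have powE : (2 ^ n = 2 ^ p.+1 * (8 * 2 ^ t))%N by rewrite nE expnD !expnS; lia.
have le_p : (p.+1 <= n)%N by rewrite nE leq_addr.
rewrite powE {nE powE lt_tn lt8n}; move: lb le_t lt_t.
rewrite [(2 ^ t.+3)%N]expnS [(2 ^ t.+2)%N]expnS [(2 ^ t.+1)%N]expnS {}/t.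
move: (2 ^ p.+1)%N (2 ^ _)%N (multinacci_sum _ _) => P T S lb le_t lt_t.
have le_PS : (P <= 4 * S)%N.
  have le_pP : (p.+1 * P <= 2 * T * P)%N.
    by rewrite leq_mul2r (leq_trans le_p (ltnW lt_t)) orbT.
  have T_gt0 : (0 < 2 * T)%N by apply: leq_trans lt_t.
  by rewrite -(leq_pmul2l T_gt0); move: lb le_pP; lia.
apply: (leq_trans (leq_mul le_PS (leq_mul (leqnn 8) le_t))).
by rewrite mulnACA (mulnC S) mulnA.
Qed.

Lemma ltr_natfrac (R : numFieldType) (k n m d : nat) :
    (0 < k)%N -> (0 < n)%N -> (m < k * n * d)%N ->
  1 / k%:R * (m%:R / n%:R) < d%:R :> R.
Proof.
move=> k_gt0 n_gt0 lt_m.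
rewrite mul1r mulrA ltr_pdivrMr ?ltr0n // ltr_pdivrMl ?ltr0n //.
by rewrite -!natrM ltr_nat (mulnC d) mulnA.
Qed.

Theorem corollary3p5 (n : nat) (n_ge1 : (1 <= n)%N) :
  (min_nondet n)%:R > 1 / 201%:R * (2%:R ^+ n / n%:R) :> rat.
Proof.
rewrite /min_nondet; case: ex_minnP => d d_notin _.
suff lt_d : (2 ^ n < 201 * n * d)%N.
  by rewrite -natrX; apply: ltr_natfrac.
rewrite ltnNge; apply: contra d_notin => le_d.
have [lt_n6 | le6n] := ltnP n 6.
  (* Here [2 ^ n < 201 * n], which leaves only the determinant 0. *)
  have -> : d = 0%N.
    have : (2 ^ n <= 2 ^ 5)%N by rewrite leq_exp2l.
    by move: (2 ^ n)%N le_d => P; nia.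
  case: (n) n_ge1 => [//|k] _; apply/detsetP.
  by exists 0 => [i j|]; [left; rewrite mxE | rewrite det0].
have [p [q [nE le_S]]] := multinacci_sum_large _ le6n.
rewrite nE; apply: multinacci_sum_detset.
rewrite -(leq_pmul2l (_ : 0 < 201 * n)%N) ?muln_gt0 ?n_ge1 //.
apply: leq_trans le_d (leq_trans le_S _).
by rewrite leq_mul2r leq_mul2r !orbT.
Qed.
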